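(* Let $D=\{(x,y)\in\mathbb{R}^2:x^2+y^2<\frac12\}$. For $(x,y)\in D$, the quadruple $$(p_n,p_e,p_s,p_w)=(\mathcal{P}(x,y),\mathcal{P}(-y,x),\mathcal{P}(-x,-y),\mathcal{P}(y,-x))$$ uniquely determines $(x,y)$. Moreover, on $D$ the map $$(x,y)\mapsto\left(\frac{\partial\mathcal{H}}{\partial x},\frac{\partial\mathcal{H}}{\partial y}\right)$$ is one-to-one, and its range is $\{(s,t)\in\mathbb{R}^2:|s|+|t|<2\}$.
   Context: For $|x|+|y|\le1$, $(x,y)\neq(\pm\frac12,\frac12)$, define $\mathcal{P}(x,y)=0$ if $x^2+y^2\ge\frac12$ and $y<\frac12$; $\mathcal{P}(x,y)=1$ if $x^2+y^2\ge\frac12$ and $y>\frac12$; and $\mathcal{P}(x,y)=\frac12+\frac1\pi\tan^{-1}\left(\frac{2y-1}{\sqrt{1-2x^2-2y^2}}\right)$ if $x^2+y^2<\frac12$. (This is the limiting probability, near normalized location $(x,y)$, of north-going dominos in uniformly random domino tilings of large Aztec diamonds; $p_n,p_e,p_s,p_w$ are the limiting north-, east-, south- and west-going placement probabilities near $(x,y)$.) The limiting normalized average height function is $$\mathcal{H}(x,y)=2\left(y\mathcal{P}(x,y)-y\mathcal{P}(-x,-y)+(1-x)\mathcal{P}(-y,x)+(1+x)\mathcal{P}(y,-x)\right),$$ and it satisfies $\frac{\partial\mathcal{H}}{\partial x}=2\mathcal{P}(y,-x)-2\mathcal{P}(-y,x)$ and $\frac{\partial\mathcal{H}}{\partial y}=2\mathcal{P}(x,y)-2\mathcal{P}(-x,-y)$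 on $D$ (the temperate zone in normalized coordinates). *)

(* Defs.v *)
From Stdlib Require Import Reals.
From Coquelicot Require Import Coquelicot.
Local Open Scope R_scope.

(* calP is the limiting probability of north-going dominos.  It is meant for
   |x| + |y| <= 1 with (x, y) different from (1/2, 1/2) and (-1/2, 1/2);
   elsewhere its value is a default.  Within the diamond |x| + |y| <= 1, those
   two points are the only ones with x^2 + y^2 >= 1/2 and y = 1/2, so the last
   branch means y > 1/2. *)
Definition calP (x y : R) : R :=
  if Rlt_dec (x ^ 2 + y ^ 2) (1 / 2) then
    1 / 2 + 1 / PI * atan ((2 * y - 1) / sqrt (1 - 2 * x ^ 2 - 2 * y ^ 2))
  else if Rlt_dec y (1 / 2) then 0
  else 1.

(* The limiting normalized average height function. *)
Definition height (x y : R) : R :=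
  2 * (y * calP x y - y * calP (- x) (- y) + (1 - x) * calP (- y) x
       + (1 + x) * calP y (- x)).

Definition temperate (z : R * R) : Prop := fst z ^ 2 + snd z ^ 2 < 1 / 2.

(* The quadruple (p_n, p_e, p_s, p_w). *)
Definition placement (z : R * R) : R * R * R * R :=
  let (x, y) := z in (calP x y, calP (- y) x, calP (- x) (- y), calP y (- x)).

(* [Derive] returns a default value where the derivative does not exist, so
   [grad_height] is the gradient only where [has_partials_height] holds. *)
Definition grad_height (z : R * R) : R * R :=
  let (x, y) := z in
  (Derive (fun u => height u y) x, Derive (fun v => height x v) y).

Definition has_partials_height (z : R * R) : Prop :=
  let (x, y) := z in
  ex_derive (fun u => height u y) x /\ ex_derive (fun v => height x v) y.

Definition injective_on {A B : Type} (S : A -> Prop) (f : A -> B) : Prop :=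
  forall a b : A, S a -> S b -> f a = f b -> a = b.

(* Main.v *)
Require Import Defs.
From Stdlib Require Import Reals.
From Coquelicot Require Import Coquelicot.
From Stdlib Require Import Lra Psatz.
Local Open Scope R_scope.

(** Write r for sqrt(1 - 2x^2 - 2y^2), p = atan((x+y)/r) and q = atan((x-y)/r).
    The arctangent identity
    atan((2x+1)/r) + atan((2x-1)/r) = p + q,
    together with its mirror image under exchange of x and y, turns the gradient
    of the height function into (-(2/pi)(p+q), (2/pi)(p-q)).  The map
    (x,y) |-> (x/r, y/r) is a bijection from the disk to the plane, so (p,q)
    ranges bijectively over the square |p|, |q| < pi/2, which is the diamond
    |s| + |t| < 2 in the coordinates (s,t).  The placement probabilities
    determine the gradient, hence also (x,y). *)

(** * The radical and the geometry of the disk *)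

Definition rad (x y : R) : R := sqrt (1 - 2 * x ^ 2 - 2 * y ^ 2).

Lemma rad_gt0 (x y : R) : x ^ 2 + y ^ 2 < 1 / 2 -> 0 < rad x y.
Proof. intros H; apply sqrt_lt_R0; lra. Qed.

Lemma rad_sqr (x y : R) :
  x ^ 2 + y ^ 2 < 1 / 2 -> rad x y ^ 2 = 1 - 2 * x ^ 2 - 2 * y ^ 2.
Proof. intros H; unfold rad; rewrite pow2_sqrt; lra. Qed.

Lemma radC (x y : R) : rad x y = rad y x.
Proof. unfold rad; f_equal; ring. Qed.

Lemma radNN (x y : R) : rad (- x) (- y) = rad x y.
Proof. unfold rad; f_equal; ring. Qed.

Lemma radNl (x y : R) : rad (- x) y = rad x y.
Proof. unfold rad; f_equal; ring. Qed.

(** Since (x + y)^2 + (x - y)^2 = 2 (x^2 + y^2) < 1, both |x + y| and |x - y| are below 1. These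
    four linear forms are the factors of the denominators in the derivatives of [calP]. *)
Lemma disk_in_diamond (x y : R) : x ^ 2 + y ^ 2 < 1 / 2 ->
  0 < 1 - x - y /\ 0 < 1 - x + y /\ 0 < 1 + x - y /\ 0 < 1 + x + y.
Proof.
intros H; pose proof (pow2_ge_0 (x + y)); pose proof (pow2_ge_0 (x - y)).
repeat split; nra.
Qed.

Lemma calP_disk (x y : R) : x ^ 2 + y ^ 2 < 1 / 2 ->
  calP x y = 1 / 2 + 1 / PI * atan ((2 * y - 1) / rad x y).
Proof.
intros H; unfold calP, rad.
destruct (Rlt_dec (x ^ 2 + y ^ 2) (1 / 2)); [reflexivity | contradiction].
Qed.

(** * Partial derivatives of [calP] and [height] *)

Lemma is_derive_atan_div (f g : R -> R) (x df dg : R) :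
  is_derive f x df -> is_derive g x dg -> 0 < g x ->
  is_derive (fun u => atan (f u / g u)) x
    ((df * g x - f x * dg) / (g x ^ 2 + f x ^ 2)).
Proof.
intros Hf Hg Hpos.
auto_derive.
- repeat split; [eexists; eassumption | eexists; eassumption | lra].
- rewrite (is_derive_unique (fun u : R => f u) _ _ Hf),
    (is_derive_unique (fun u : R => g u) _ _ Hg).
  field; split; [nra | lra].
Qed.

Lemma is_derive_rad (x y : R) : x ^ 2 + y ^ 2 < 1 / 2 ->
  is_derive (fun u => rad u y) x (- 2 * x / rad x y).
Proof.
intros H; pose proof (rad_gt0 _ _ H) as Hr; unfold rad in *.
auto_derive; [lra |].
replace (1 + - (2 * (x * (x * 1))) + - (2 * (y * (y * 1))))
  with (1 - 2 * x ^ 2 - 2 * y ^ 2) by ring.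
field; lra.
Qed.

(** By openness of the disk, the arctangent branch of [calP] is valid near each of its points, as
    differentiating the case distinction requires. *)
Lemma locally_disk (x y : R) : x ^ 2 + y ^ 2 < 1 / 2 ->
  locally x (fun u => u ^ 2 + y ^ 2 < 1 / 2).
Proof.
intros H.
assert (C : continuous (fun u : R => u ^ 2 + y ^ 2) x).
{ apply (ex_derive_continuous (fun u : R => u ^ 2 + y ^ 2)); auto_derive; easy. }
exact (C _ (open_lt (1 / 2) _ H)).
Qed.

Lemma is_derive_calP_l (x y : R) : x ^ 2 + y ^ 2 < 1 / 2 ->
  is_derive (fun u => calP u y) x
    (1 / PI * (x * (2 * y - 1) / (rad x y * (1 - x - y) * (1 + x - y)))).
Proof.
intros H.
pose proof (rad_gt0 _ _ H) as Hr; pose proof (rad_sqr _ _ H) as Hr2.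
destruct (disk_in_diamond _ _ H) as (H1 & H2 & H3 & H4).
apply (is_derive_ext_loc
  (fun u => 1 / 2 + 1 / PI * atan ((2 * y - 1) / rad u y))).
{ apply (filter_imp _ _ (fun u Hu => eq_sym (calP_disk u y Hu))).
  now apply locally_disk. }
pose proof (is_derive_atan_div (fun _ => 2 * y - 1) (fun u => rad u y) x 0 _
  (is_derive_const _ _) (is_derive_rad x y H) Hr) as HA; cbv beta in HA.
evar_last.
{ apply (is_derive_plus (fun _ => 1 / 2)); [apply is_derive_const |].
  apply (is_derive_scal _ x (1 / PI)), HA. }
change (0 + 1 / PI * ((0 * rad x y - (2 * y - 1) * (- 2 * x / rad x y)) /
   (rad x y ^ 2 + (2 * y - 1) ^ 2)) =
  1 / PI * (x * (2 * y - 1) / (rad x y * (1 - x - y) * (1 + x - y)))).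
(* The sum is 2 ((1 - y)^2 - x^2). Its linear factors recur in the derivatives at the rotated
   points, which allows the cancellation in the gradient of [height]. *)
replace (rad x y ^ 2 + (2 * y - 1) ^ 2)
  with (2 * (1 - x - y) * (1 + x - y)) by (rewrite Hr2; ring).
field; repeat split; try lra; exact PI_neq0.
Qed.

Lemma is_derive_calP_r (x y : R) : x ^ 2 + y ^ 2 < 1 / 2 ->
  is_derive (fun v => calP x v) y
    (1 / PI * ((1 - y - 2 * x ^ 2) / (rad x y * (1 - x - y) * (1 + x - y)))).
Proof.
intros H.
(* [is_derive_rad] and [locally_disk] vary the first coordinate, so they are applied with the
   coordinates exchanged. *)
assert (H' : y ^ 2 + x ^ 2 < 1 / 2) by lra.
pose proof (rad_gt0 _ _ H') as Hr; pose proof (rad_sqr _ _ H') as Hr2.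
destruct (disk_in_diamond _ _ H) as (H1 & H2 & H3 & H4).
apply (is_derive_ext_loc
  (fun v => 1 / 2 + 1 / PI * atan ((2 * v - 1) / rad v x))).
{ generalize (locally_disk _ _ H'); apply filter_imp; intros v Hv.
  rewrite calP_disk, (radC x v); [reflexivity | lra]. }
assert (Hl : is_derive (fun v : R => 2 * v - 1) y 2) by (auto_derive; [easy | ring]).
pose proof (is_derive_atan_div _ (fun v => rad v x) y 2 _
  Hl (is_derive_rad y x H') Hr) as HA; cbv beta in HA.
evar_last.
{ apply (is_derive_plus (fun _ => 1 / 2)); [apply is_derive_const |].
  apply (is_derive_scal _ y (1 / PI)), HA. }
rewrite (radC x y).
change (0 + 1 / PI * ((2 * rad y x - (2 * y - 1) * (- 2 * y / rad y x)) /
   (rad y x ^ 2 + (2 * y - 1) ^ 2)) =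
  1 / PI * ((1 - y - 2 * x ^ 2) / (rad y x * (1 - x - y) * (1 + x - y)))).
(* Over the common denominator only the square of the radical is left in the numerator; [rad_sqr]
   reduces it to 2 (1 - y - 2 x^2). *)
replace (2 * rad y x - (2 * y - 1) * (- 2 * y / rad y x))
  with ((2 * rad y x ^ 2 + 2 * y * (2 * y - 1)) / rad y x) by (field; lra).
replace (rad y x ^ 2 + (2 * y - 1) ^ 2)
  with (2 * (1 - x - y) * (1 + x - y)) by (rewrite Hr2; ring).
rewrite Hr2.
field; repeat split; try lra; exact PI_neq0.
Qed.

(** In the product rule, the stated value comes from differentiating the weights 1 - x and 1 + x.
    The terms with derivatives of [calP] cancel: all four carry the same radical, and their
    denominators share linear factors. *)
Lemma is_derive_height_l (x y : R) : x ^ 2 + y ^ 2 < 1 / 2 ->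
  is_derive (fun u => height u y) x (2 * calP y (- x) - 2 * calP (- y) x).
Proof.
intros H.
assert (Hn : (- x) ^ 2 + (- y) ^ 2 < 1 / 2) by lra.
assert (He : (- y) ^ 2 + x ^ 2 < 1 / 2) by lra.
assert (Hw : y ^ 2 + (- x) ^ 2 < 1 / 2) by lra.
pose proof (is_derive_calP_l _ _ H) as D1.
pose proof (is_derive_calP_l _ _ Hn) as D2.
pose proof (is_derive_calP_r _ _ He) as D3.
pose proof (is_derive_calP_r _ _ Hw) as D4.
rewrite radNN in D2; rewrite radNl, radC in D3.
rewrite radC, radNl in D4.
pose proof (rad_gt0 _ _ H) as Hr.
destruct (disk_in_diamond _ _ H) as (H1 & H2 & H3 & H4).
unfold height; auto_derive.
- repeat split; eexists; eassumption.
- rewrite (is_derive_unique (fun u : R => calP u y) _ _ D1),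
    (is_derive_unique (fun u : R => calP u (- y)) _ _ D2),
    (is_derive_unique (fun u : R => calP (- y) u) _ _ D3),
    (is_derive_unique (fun u : R => calP y u) _ _ D4).
  field; repeat split; try lra; exact PI_neq0.
Qed.

Lemma is_derive_height_r (x y : R) : x ^ 2 + y ^ 2 < 1 / 2 ->
  is_derive (fun v => height x v) y (2 * calP x y - 2 * calP (- x) (- y)).
Proof.
intros H.
assert (Hn : (- x) ^ 2 + (- y) ^ 2 < 1 / 2) by lra.
assert (He : (- y) ^ 2 + x ^ 2 < 1 / 2) by lra.
assert (Hw : y ^ 2 + (- x) ^ 2 < 1 / 2) by lra.
pose proof (is_derive_calP_r _ _ H) as D1.
pose proof (is_derive_calP_r _ _ Hn) as D2.
pose proof (is_derive_calP_l _ _ He) as D3.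
pose proof (is_derive_calP_l _ _ Hw) as D4.
rewrite radNN in D2; rewrite radNl, radC in D3.
rewrite radC, radNl in D4.
pose proof (rad_gt0 _ _ H) as Hr.
destruct (disk_in_diamond _ _ H) as (H1 & H2 & H3 & H4).
unfold height; auto_derive.
- repeat split; eexists; eassumption.
- rewrite (is_derive_unique (fun v : R => calP x v) _ _ D1),
    (is_derive_unique (fun v : R => calP (- x) v) _ _ D2),
    (is_derive_unique (fun v : R => calP v x) _ _ D3),
    (is_derive_unique (fun v : R => calP v (- x)) _ _ D4).
  field; repeat split; try lra; exact PI_neq0.
Qed.

(** * Arctangent identities *)

Lemma atan_sub_eq (u v w : R) :
  0 < 1 + u * v -> u - v = w * (1 + u * v) -> atan u - atan v = atan w.
Proof.
intros Hpos Hw.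
pose proof (atan_bound u) as Bu; pose proof (atan_bound v) as Bv.
assert (Cu : 0 < cos (atan u)) by (apply cos_gt_0; lra).
assert (Cv : 0 < cos (atan v)) by (apply cos_gt_0; lra).
(* The difference lies in (-PI, PI), so a positive cosine confines it to (-PI/2, PI/2), where [atan]
   inverts [tan]. *)
assert (Hcos : 0 < cos (atan u - atan v)).
{ assert (Hprod : cos (atan u - atan v)
    = cos (atan u) * cos (atan v) * (1 + tan (atan u) * tan (atan v))).
  { rewrite cos_minus; unfold tan; field; lra. }
  rewrite Hprod, !tan_atan; repeat apply Rmult_lt_0_compat; assumption. }
assert (Hd : - (PI / 2) < atan u - atan v < PI / 2).
{ split; apply Rnot_le_lt; intros Hle.
  - rewrite <- cos_neg in Hcos.
    assert (cos (- (atan u - atan v)) <= 0) by (apply cos_le_0; lra). lra.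
  - assert (cos (atan u - atan v) <= 0) by (apply cos_le_0; lra). lra. }
rewrite <- (atan_tan (atan u - atan v)) by lra.
f_equal.
rewrite tan_minus by (rewrite ?tan_atan; lra).
rewrite !tan_atan, Hw; field; lra.
Qed.

Lemma atan_sum_disk_aux (x y r : R) :
  0 < r -> r ^ 2 = 1 - 2 * x ^ 2 - 2 * y ^ 2 -> 0 <= y ->
  atan ((2 * x + 1) / r) + atan ((2 * x - 1) / r)
  = atan ((x + y) / r) + atan ((x - y) / r).
Proof.
intros Hr Hr2 Hy.
assert (H : x ^ 2 + y ^ 2 < 1 / 2) by nra.
destruct (disk_in_diamond _ _ H) as (H1 & H2 & H3 & H4).
(* Both [atan ((2x+1)/r) - atan ((x+y)/r)] and
   [atan ((x-y)/r) - atan ((2x-1)/r)] are [atan (r / (1+2y))]. *)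
assert (E1 : 1 + (2 * x + 1) / r * ((x + y) / r)
             = (1 + x - y) * (1 + 2 * y) / r ^ 2).
{ replace (1 + (2 * x + 1) / r * ((x + y) / r))
    with ((r ^ 2 + (2 * x + 1) * (x + y)) / r ^ 2) by (field; lra).
  f_equal; rewrite Hr2; ring. }
assert (E2 : 1 + (x - y) / r * ((2 * x - 1) / r)
             = (1 - x - y) * (1 + 2 * y) / r ^ 2).
{ replace (1 + (x - y) / r * ((2 * x - 1) / r))
    with ((r ^ 2 + (x - y) * (2 * x - 1)) / r ^ 2) by (field; lra).
  f_equal; rewrite Hr2; ring. }
assert (A1 := atan_sub_eq ((2 * x + 1) / r) ((x + y) / r) (r / (1 + 2 * y))).
assert (A2 := atan_sub_eq ((x - y) / r) ((2 * x - 1) / r) (r / (1 + 2 * y))).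
rewrite E1 in A1; rewrite E2 in A2.
assert (Hr2pos : 0 < r ^ 2) by nra.
assert (B1 := A1 ltac:(apply Rdiv_lt_0_compat; nra) ltac:(field; lra)).
assert (B2 := A2 ltac:(apply Rdiv_lt_0_compat; nra) ltac:(field; lra)).
lra.
Qed.

Lemma atan_sum_disk (x y r : R) :
  0 < r -> r ^ 2 = 1 - 2 * x ^ 2 - 2 * y ^ 2 ->
  atan ((2 * x + 1) / r) + atan ((2 * x - 1) / r)
  = atan ((x + y) / r) + atan ((x - y) / r).
Proof.
intros Hr Hr2; destruct (Rle_dec 0 y) as [Hy | Hy].
- now apply atan_sum_disk_aux.
- rewrite (atan_sum_disk_aux x (- y) r); [| lra | nra | lra].
  unfold Rminus; rewrite Ropp_involutive; ring.
Qed.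

(** * The gradient in arctangent coordinates *)

Definition slope (z : R * R) : R * R :=
  let (x, y) := z in
  (atan ((x + y) / rad x y), atan ((x - y) / rad x y)).

Lemma grad_height_placement (z : R * R) : temperate z ->
  grad_height z =
  let '(pn, pe, ps, pw) := placement z in (2 * pw - 2 * pe, 2 * pn - 2 * ps).
Proof.
destruct z as [x y]; unfold temperate; simpl fst; simpl snd; intros H.
unfold grad_height, placement; f_equal; apply is_derive_unique.
- now apply is_derive_height_l.
- now apply is_derive_height_r.
Qed.

Lemma grad_height_slope (z : R * R) : temperate z ->
  grad_height z =
  let (p, q) := slope z in (- (2 / PI) * (p + q), 2 / PI * (p - q)).
Proof.
intros Hz; rewrite (grad_height_placement z Hz).
destruct z as [x y]; unfold temperate in Hz; simpl in Hz.
assert (H : x ^ 2 + y ^ 2 < 1 / 2) by (simpl; lra).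
unfold placement, slope.
rewrite !calP_disk by lra.
rewrite radNN, radNl, (radC y (- x)), radNl, (radC y x).
pose proof (rad_gt0 _ _ H) as Hr; pose proof (rad_sqr _ _ H) as Hr2.
pose proof (atan_sum_disk x y (rad x y) Hr Hr2) as Ex.
pose proof (atan_sum_disk y x (rad x y) Hr ltac:(lra)) as Ey.
(* Oddness of [atan] turns the differences of probabilities at opposite points into the sums handled
   by [atan_sum_disk]; the constants 1/2 cancel. *)
replace ((2 * - x - 1) / rad x y) with (- ((2 * x + 1) / rad x y)) by (field; lra).
replace ((2 * - y - 1) / rad x y) with (- ((2 * y + 1) / rad x y)) by (field; lra).
replace ((y - x) / rad x y) with (- ((x - y) / rad x y)) in Ey by (field; lra).
replace (y + x) with (x + y) in Ey by ring.
rewrite !atan_opp in *.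
pose proof PI_neq0.
f_equal.
- rewrite <- Ex; field; assumption.
- replace (atan ((x + y) / rad x y) - atan ((x - y) / rad x y))
    with (atan ((2 * y + 1) / rad x y) + atan ((2 * y - 1) / rad x y)) by lra.
  field; assumption.
Qed.

(** * Bijectivity of [slope] from the disk to the square *)

Lemma slope_injective : injective_on temperate slope.
Proof.
intros [x y] [x' y']; unfold temperate, slope; simpl fst; simpl snd.
intros H H' E; injection E as Ep Eq.
pose proof (rad_gt0 _ _ H) as Hr; pose proof (rad_sqr _ _ H) as Hr2.
pose proof (rad_gt0 _ _ H') as Hr'; pose proof (rad_sqr _ _ H') as Hr2'.
apply (f_equal tan) in Ep, Eq; rewrite !tan_atan in Ep, Eq.
set (r := rad x y) in *; set (r' := rad x' y') in *.
set (a := x / r); set (b := y / r).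
assert (Ea : a = x' / r').
{ unfold a; replace (x / r) with (((x + y) / r + (x - y) / r) / 2) by (field; lra).
  rewrite Ep, Eq; field; lra. }
assert (Eb : b = y' / r').
{ unfold b; replace (y / r) with (((x + y) / r - (x - y) / r) / 2) by (field; lra).
  rewrite Ep, Eq; field; lra. }
assert (Hx : x = a * r) by (unfold a; field; lra).
assert (Hy : y = b * r) by (unfold b; field; lra).
assert (Hx' : x' = a * r') by (rewrite Ea; field; lra).
assert (Hy' : y' = b * r') by (rewrite Eb; field; lra).
(* This is [rad_sqr] with x = a r and y = b r: the ratios a and b determine the positive number r,
   hence the point. *)
assert (S : r ^ 2 * (1 + 2 * a ^ 2 + 2 * b ^ 2) = 1).
{ rewrite Hx, Hy in Hr2; lra. }
assert (S' : r' ^ 2 * (1 + 2 * a ^ 2 + 2 * b ^ 2) = 1).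
{ rewrite Hx', Hy' in Hr2'; lra. }
assert (Err : r ^ 2 = r' ^ 2).
{ apply Rmult_eq_reg_r with (1 + 2 * a ^ 2 + 2 * b ^ 2); nra. }
assert (Er : r = r') by nra.
rewrite Hx, Hy, Hx', Hy', Er; reflexivity.
Qed.

Lemma slope_surjective (p q : R) :
  - PI / 2 < p < PI / 2 -> - PI / 2 < q < PI / 2 ->
  exists z : R * R, temperate z /\ slope z = (p, q).
Proof.
intros Hp Hq.
(* The ratios x/r and y/r must solve a + b = tan p and a - b = tan q; then r^2 (1 + 2 a^2 + 2 b^2) =
   1 forces r = 1 / sqrt k. *)
set (a := (tan p + tan q) / 2); set (b := (tan p - tan q) / 2).
set (k := 1 + 2 * a ^ 2 + 2 * b ^ 2).
assert (Hk : 1 <= k) by (unfold k; nra).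
set (r := / sqrt k).
assert (Hs : 0 < sqrt k) by (apply sqrt_lt_R0; lra).
assert (Hr : 0 < r) by now apply Rinv_0_lt_compat.
assert (Hr2 : r ^ 2 * k = 1).
{ unfold r; rewrite <- (pow2_sqrt k) at 2 by lra; field; lra. }
assert (Hrad : rad (a * r) (b * r) = r).
{ unfold rad.
  replace (1 - 2 * (a * r) ^ 2 - 2 * (b * r) ^ 2) with (r ^ 2)
    by (unfold k in Hr2; lra).
  apply sqrt_pow2; lra. }
exists (a * r, b * r); split.
- unfold temperate; simpl fst; simpl snd; unfold k in Hr2; nra.
- unfold slope; rewrite Hrad.
  replace ((a * r + b * r) / r) with (tan p) by (unfold a, b; field; lra).
  replace ((a * r - b * r) / r) with (tan q) by (unfold a, b; field; lra).
  rewrite !atan_tan by lra; reflexivity.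
Qed.

(** * Injectivity and range of the gradient *)

Lemma grad_height_injective : injective_on temperate grad_height.
Proof.
intros z z' Hz Hz' E.
apply slope_injective; try assumption.
rewrite (grad_height_slope z Hz), (grad_height_slope z' Hz') in E.
destruct (slope z) as [p q], (slope z') as [p' q'].
injection E as E1 E2.
pose proof PI_RGT_0 as HPI.
assert (0 < 2 / PI) by (apply Rdiv_lt_0_compat; lra).
assert (p + q = p' + q') by nra.
assert (p - q = p' - q') by nra.
f_equal; lra.
Qed.

Theorem mainTheorem5 :
  injective_on temperate placement /\
  (forall z : R * R, temperate z -> has_partials_height z) /\
  injective_on temperate grad_height /\
  (forall s t : R,
     (exists z : R * R, temperate z /\ grad_height z = (s, t)) <->
     Rabs s + Rabs t < 2).
Proof.
pose proof PI_RGT_0 as HPI.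
split; [| split; [| split]].
- intros z z' Hz Hz' E; apply grad_height_injective; try assumption.
  rewrite !grad_height_placement, E by assumption; reflexivity.
- intros [x y] H; split; eexists.
  + now apply is_derive_height_l.
  + now apply is_derive_height_r.
- exact grad_height_injective.
- intros s t; split.
  + intros (z & Hz & E); rewrite (grad_height_slope z Hz) in E.
    destruct z as [x y]; unfold slope in E.
    pose proof (atan_bound ((x + y) / rad x y)) as Bp.
    pose proof (atan_bound ((x - y) / rad x y)) as Bq.
    set (p := atan ((x + y) / rad x y)) in *.
    set (q := atan ((x - y) / rad x y)) in *.
    injection E as Es Et.
    (* Each of these combinations isolates one angle, so the square becomes |t - s| < 2 and |s + t|
       < 2, which together say |s| + |t| < 2. *)
    assert (Ep : t - s = 4 * p / PI) by (rewrite <- Es, <- Et; field; lra).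
    assert (Eq : - (s + t) = 4 * q / PI) by (rewrite <- Es, <- Et; field; lra).
    assert (Bound : forall c d : R,
      - PI / 2 < c < PI / 2 -> d = 4 * c / PI -> - 2 < d < 2).
    { intros c d Hc ->; split.
      - apply Rlt_div_r; lra.
      - apply Rlt_div_l; lra. }
    pose proof (Bound _ _ Bp Ep); pose proof (Bound _ _ Bq Eq).
    unfold Rabs; destruct (Rcase_abs s), (Rcase_abs t); lra.
  + intros Hst.
    assert (B : - 2 < t - s < 2 /\ - 2 < - (s + t) < 2).
    { revert Hst; unfold Rabs; destruct (Rcase_abs s), (Rcase_abs t); lra. }
    (* The angles come from solving t - s = 4p/PI and -(s + t) = 4q/PI. *)
    destruct (slope_surjective (PI / 4 * (t - s)) (PI / 4 * - (s + t)))
      as (z & Hz & E); [nra | nra |].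
    exists z; split; [exact Hz |].
    rewrite (grad_height_slope z Hz), E; f_equal; field; lra.
Qed.
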